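(* The group $\mathrm{Isom}_e(K_0(\mathbb{P}_5))$ is isomorphic to $\mathbb{Z}^3$ and is generated by the operators \begin{align*} & E\mapsto E\otimes\mathcal{O}(1),\\ & E\mapsto E\otimes(\mathcal{O}+2\mathcal{O}_{\mathbb{P}_2}+3\mathcal{O}_{\mathbb{P}_1}+4\mathcal{O}_{\mathbb{P}_0}),\\ & E\mapsto E\otimes(\mathcal{O}+\mathcal{O}_{\mathbb{P}_0}). \end{align*}
   Context: Here $n=5$ in the following. $K_0(\mathbb{P}_n)$ is the Grothendieck group of coherent sheaves on the $n$-dimensional projective space $\mathbb{P}_n$ over a fixed ground field; it is a free $\mathbb{Z}$-module of rank $n+1$ with basis the classes of $\mathcal{O},\mathcal{O}(1),\dots,\mathcal{O}(n)$. A sheaf and its class are denoted by the same letter. The Euler form is the (nonsymmetric) nondegenerate bilinear form $\chi(E,F)=\sum_\nu(-1)^\nu\dim\mathrm{Ext}^\nu(E,F)$; it satisfies $\chi(\mathcal{O}(k),\mathcal{O}(m))=\binom{n+m-k}{n}$ for all $k,m\in\mathbb{Z}$, where $\binom{x}{n}=\frac{x(x-1)\cdots(x-n+1)}{n!}$. It is extended $\mathbb{R}$-bilinearly to $K_0(\mathbb{P}_n)\otimes\mathbb{R}$. $\mathrm{Isom}(K_0(\mathbb{P}_n))$ is the group of $\mathbb{Z}$-linear automorphisms of $K_0(\mathbb{P}_n)$ preserving $\chi$; $\mathrm{Isom}(K_0(\mathbb{P}_n)\otimes\mathbb{R})\subset GL(n+1,\mathbb{R})$ is the group of $\mathbb{R}$-linear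 automorphisms of $K_0(\mathbb{P}_n)\otimes\mathbb{R}$ preserving $\chi$, and $\mathrm{Isom}_e(K_0(\mathbb{P}_n)\otimes\mathbb{R})$ is its connected component of the identity. Regarding $\mathrm{Isom}(K_0(\mathbb{P}_n))$ as a subgroup of $\mathrm{Isom}(K_0(\mathbb{P}_n)\otimes\mathbb{R})$, one sets $\mathrm{Isom}_e(K_0(\mathbb{P}_n))=\mathrm{Isom}(K_0(\mathbb{P}_n))\cap \mathrm{Isom}_e(K_0(\mathbb{P}_n)\otimes\mathbb{R})$. The symbol $\otimes$ between classes denotes the commutative ring structure on $K_0(\mathbb{P}_n)$ induced by tensor product of locally free sheaves; it is the bilinear product with $\mathcal{O}(k)\otimes\mathcal{O}(m)=\mathcal{O}(k+m)$ for all $k,m\in\mathbb{Z}$. For $0\leqslant m\leqslant n$, $\mathcal{O}_{\mathbb{P}_m}$ is the class of the structure sheaf of an $m$-dimensional linear subspace $\mathbb{P}_m\subset\mathbb{P}_n$ (so $\mathcal{O}_{\mathbb{P}_n}=\mathcal{O}$); in the ring $K_0(\mathbb{P}_n)$ one has $\mathcal{O}_{\mathbb{P}_m}=(\mathcal{O}-\mathcal{O}(-1))^{n-m}$. *)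

(* Defs.v *)
From HB Require Import structures.
From mathcomp Require Import all_boot all_order all_algebra.
From mathcomp Require Import all_classical all_reals topology normedtype.
From mathcomp Require Import ring lra zify.

Set Implicit Arguments.
Unset Strict Implicit.
Unset Printing Implicit Defensive.

Import Order.TTheory GRing.Theory Num.Theory.
Import numFieldNormedType.Exports.

Local Open Scope classical_set_scope.
Local Open Scope ring_scope.

(* x (x - 1) ... (x - n + 1) / n!, for possibly negative x *)
Definition binq (x : int) (n : nat) : rat :=
  (\prod_(i < n) (x - i%:Z)%:Q) / n`!%:R.

(* The Grothendieck ring of coherent sheaves on the n-dimensional projective
   space, with its Euler form. No theory of coherent sheaves is available, so
   the ring enters through the facts that determine (K, O(k), chi) up to a
   unique isomorphism: the basis O, O(1), ..., O(n), the tensor product of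
   the O(k), and the bilinear form chi. The ring product is the tensor product
   of classes. *)
Record K0P (n : nat) := {
  K0_ring :> comNzRingType;
  OO : int -> K0_ring;
  chi : K0_ring -> K0_ring -> int;
  OO_basis : bijective
    (fun c : 'I_n.+1 -> int => \sum_(i < n.+1) OO (val i)%:Z *~ c i);
  OO_tensor : forall k m : int, OO k * OO m = OO (k + m);
  chiDl : forall E E' F, chi (E + E') F = chi E F + chi E' F;
  chiDr : forall E F F', chi E (F + F') = chi E F + chi E F';
  chi_OO : forall k m : int, (chi (OO k) (OO m))%:Q = binq (n%:Z + m - k) n }.

Arguments OO {n} K : rename.
Arguments chi {n} K : rename.

Section Definitions.
Variables (R : realType) (n : nat) (K : K0P n).

(* class of the structure sheaf of an m-dimensional linear subspace, m <= n *)
Definition OP (m : nat) : K := (OO K 0 - OO K (-1)) ^+ (n - m).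

Definition tensor (a : K) : K -> K := fun E => E * a.

Definition Isom : set (K -> K) :=
  [set f | [/\ zmod_morphism f, bijective f &
               forall E F, chi K (f E) (f F) = chi K E F]].

(* K (x) R is identified with 'cV[R]_n.+1 by the basis O, O(1), ..., O(n) *)
Definition chiR (u v : 'cV[R]_n.+1) : R :=
  \sum_(i < n.+1) \sum_(j < n.+1)
    u i 0 * v j 0 * (chi K (OO K (val i)%:Z) (OO K (val j)%:Z))%:~R.

Definition IsomR : set 'M[R]_n.+1 :=
  [set A | A \in unitmx /\
           forall u v, chiR (A *m u) (A *m v) = chiR u v].

Definition IsomR_e : set 'M[R]_n.+1 := connected_component IsomR 1%:M.

Definition matrix_of (f : K -> K) (A : 'M[int]_n.+1) : Prop :=
  forall j : 'I_n.+1,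
    f (OO K (val j)%:Z) = \sum_(i < n.+1) OO K (val i)%:Z *~ A i j.

Definition Isom_e : set (K -> K) :=
  [set f | Isom f /\
           exists2 A, matrix_of f A & IsomR_e (map_mx intr A)].

End Definitions.

Arguments Isom_e R {n} K.

Section Groups.
Variable T : Type.

(* groups of permutations of T, under composition *)
Definition bij_group (G : set (T -> T)) : Prop :=
  [/\ G id,
      forall f g, G f -> G g -> G (f \o g) &
      forall f, G f -> exists2 g, G g & cancel f g /\ cancel g f].

Definition generated (S : set (T -> T)) : set (T -> T) := smallest bij_group S.

Definition isomorphic_to_Zpow (d : nat) (G : set (T -> T)) : Prop :=
  exists2 phi : 'rV[int]_d -> (T -> T),
    (forall u v, phi (u + v) = phi u \o phi v) & set_bij setT G phi.

End Groups.

Lemma bij_group_Isom n (K : K0P n) : bij_group (@Isom n K).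
Proof.
split=> [|f g [fB fb fchi] [gB gb gchi]|f [fB [g fK gK] fchi]].
- by split=> //; exists id.
- split; [by move=> x y; rewrite /= gB fB|exact: bij_comp|].
  by move=> E F; rewrite /= fchi gchi.
- exists g; last by split.
  split; last by move=> E F; rewrite -fchi !gK.
  + by move=> x y; apply: (can_inj fK); rewrite fB !gK.
  + by exists f.
Qed.

(* K0P n is inhabited, for every n, by Z[X]/(X - 1)^(n+1) with O(1) = X. *)
Section Model.

Lemma binqS (x : int) n : binq (x + 1) n.+1 - binq x n.+1 = binq x n.
Proof.
rewrite /binq big_ord_recl /= big_ord_recr /= subr0 factS natrM.
rewrite (eq_bigr (fun i : 'I_n => (x - i%:Z)%:Q)); last first.
  by move=> i _; congr (_%:~R); rewrite /bump /=; lia.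
set P := \prod_(i < n) _.
have nz : n`!%:R != 0 :> rat by rewrite pnatr_eq0 -lt0n fact_gt0.
have nz1 : n.+1%:R != 0 :> rat by rewrite pnatr_eq0.
rewrite !rmorphD rmorphN /= -[n%:~R]/(n%:R).
by rewrite -addn1 natrD in nz1 *; field; rewrite nz nz1.
Qed.

Lemma binq_nat (m n : nat) : binq m%:Z n = 'C(m, n)%:R.
Proof.
elim: n m => [|n IHn] m; first by rewrite /binq big_ord0 bin0 divr1.
elim: m => [|m IHm].
  by rewrite /binq big_ord_recl /= subr0 !mul0r bin0n.
have /eqP := binqS m%:Z n.
rewrite subr_eq IHn IHm => /eqP; rewrite (_ : m%:Z + 1 = m.+1%:Z); last by lia.
by move->; rewrite binS natrD addrC.
Qed.

Let diff (f : int -> rat) (k : int) : rat := f (k + 1) - f k.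

Lemma int_step_eq (f : int -> rat) : (forall k, diff f k = 0) -> forall k, f k = f 0.
Proof.
move=> h; elim/int_rec => [//|m IH|m IH].
- by rewrite -IH; have /eqP := h m%:Z; rewrite subr_eq0 intS addrC => /eqP.
- rewrite -IH; have /eqP := h (- m.+1%:Z); rewrite subr_eq0 => /eqP <-.
  by congr f; lia.
Qed.

Lemma diff_uniq (N : nat) (f : int -> rat) :
    (forall k, iter N diff f k = 0) -> (forall i : nat, (i < N)%N -> f i%:Z = 0) ->
  forall k, f k = 0.
Proof.
elim: N f => [//|N IHN] f h h0 k.
rewrite (@int_step_eq f) ?h0 //.
apply: IHN => [j|i iN]; first by rewrite -iterSr.
by rewrite /diff (_ : i%:Z + 1 = i.+1%:Z) ?h0 ?subrr //; lia.
Qed.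

Lemma diffB N (f g : int -> rat) k :
  iter N diff (fun k => f k - g k) k = iter N diff f k - iter N diff g k.
Proof.
by elim: N k => [//|N IH] k; rewrite !iterS /diff -/diff !IH; ring.
Qed.

Lemma diff_binqr n N (c : int) k : iter N diff (fun k => binq (c + k) n) k =
  if (N <= n)%N then binq (c + k) (n - N) else 0.
Proof.
elim: N k => [|N IH] k; first by rewrite subn0.
rewrite iterS /diff -/diff !IH; case: (ltngtP N n) => // [lt|->].
  have -> : (n - N = (n - N.+1).+1)%N by lia.
  by rewrite addrA binqS.
by rewrite subnn /binq !big_ord0 subrr.
Qed.

Lemma diff_binql n N (c : int) k : iter N diff (fun k => binq (c - k) n) k =
  if (N <= n)%N then (-1) ^+ N * binq (c - k - N%:Z) (n - N) else 0.
Proof.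
elim: N k => [|N IH] k; first by rewrite subn0 mul1r subr0.
rewrite iterS /diff -/diff !IH; case: (ltngtP N n) => // [lt|->].
  have -> : (n - N = (n - N.+1).+1)%N by lia.
  have -> : c - k - N%:Z = (c - k - N.+1%:Z) + 1 by lia.
  have -> : c - (k + 1) - N%:Z = c - k - N.+1%:Z by lia.
  by rewrite -[binq _ (n - N.+1)]binqS exprS; ring.
by rewrite subnn /binq !big_ord0 subrr.
Qed.

Variable n : nat.

Let h : {poly int} := ('X - 1%:P) ^+ n.+1.
Let Q : comNzRingType := {poly %/ h}.

Let monic_h : h \is monic.
Proof. by rewrite monic_exp ?monicXsubC. Qed.

Let size_hE : size h = n.+2.
Proof. exact: size_exp_XsubC. Qed.

Let mk_h : mk_monic h = h.
Proof. by rewrite /mk_monic size_hE monic_h. Qed.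

Let size_h : size (mk_monic h) = n.+2.
Proof. by rewrite mk_h. Qed.

Let x : Q := in_qpoly h 'X.

Let x1n : (x - 1) ^+ n.+1 = 0.
Proof.
rewrite /x -in_qpoly1 -rmorphB -rmorphXn /=.
apply/val_inj; rewrite /= mk_h.
by rewrite Pdiv.RingMonic.rmodpp.
Qed.

Let y : Q := \sum_(i < n.+1) (1 - x) ^+ i.

Let xy : x * y = 1.
Proof.
have := subrX1 (1 - x) n.+1; rewrite -/y.
have -> : (1 - x) ^+ n.+1 = 0.
  by rewrite -opprB exprNn x1n mulr0.
move/esym/eqP; rewrite addrAC subrr !add0r mulNr eqr_oppLR opprK => /eqP //.
Qed.

Definition model_O (k : int) : Q :=
  match k with Posz m => x ^+ m | Negz m => y ^+ m.+1 end.

Lemma model_OS k : model_O (k + 1) = x * model_O k.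
Proof.
case: k => [m|[|m]].
- by rewrite (_ : Posz m + 1 = Posz m.+1) ?[LHS]exprS //; lia.
- by rewrite /= expr1 xy.
have -> : Negz m.+1 + 1 = Negz m by lia.
by rewrite /= [y ^+ m.+2]exprS mulrA xy mul1r.
Qed.

Lemma model_OP k : model_O (k - 1) = y * model_O k.
Proof.
by rewrite -[in RHS](subrK 1 k) model_OS mulrA [y * x]mulrC xy mul1r.
Qed.

Lemma model_OD k m : model_O k * model_O m = model_O (k + m).
Proof.
elim/int_rec: k => [|k IH|k IH]; first by rewrite mul1r add0r.
- rewrite (_ : k.+1%:Z = k%:Z + 1); last by lia.
  by rewrite model_OS -mulrA IH -model_OS; congr model_O; lia.
- rewrite (_ : - k.+1%:Z = - k%:Z - 1); last by lia.
  by rewrite model_OP -mulrA IH -model_OP; congr model_O; lia.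
Qed.

Let coefQ (E : Q) (i : 'I_n.+1) : int := (val E)`_i.

Let coefQD E F i : coefQ (E + F) i = coefQ E i + coefQ F i.
Proof. by rewrite /coefQ /= coefD. Qed.

Let model_O_coef (i : 'I_n.+1) : val (model_O i%:Z) = 'X^i :> {poly int}.
Proof.
rewrite /= /x -rmorphXn /= Pdiv.CommonRing.rmodp_small //.
by rewrite size_polyXn size_h ltnS.
Qed.

Let comb (c : 'I_n.+1 -> int) : Q := \sum_(i < n.+1) model_O (val i)%:Z *~ c i.

Let val_comb c : val (comb c) = \sum_(i < n.+1) c i *: 'X^i :> {poly int}.
Proof.
rewrite /comb (raddf_sum (\val : {poly_(size (mk_monic h)).-1 int} -> {poly int})).
apply: eq_bigr => i _; rewrite raddfMz -scaler_int intz; congr (_ *: _).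
exact: model_O_coef.
Qed.

Let coef_comb c i : coefQ (comb c) i = c i.
Proof.
rewrite /coefQ val_comb coef_sum (bigD1 i) //= coefZ coefXn eqxx mulr1 big1 ?addr0 //.
move=> j ji; rewrite coefZ coefXn; case: eqP => [/ord_inj e|_]; last exact: mulr0.
by rewrite e eqxx in ji.
Qed.

Let comb_coef E : comb (coefQ E) = E.
Proof.
apply: val_inj; rewrite val_comb -[RHS]coefK.
rewrite -(poly_def n.+1 (fun i => (val E)`_i)).
apply/polyP => i; rewrite !coef_poly; case: ltnP => iP; case: ltnP => // iE.
  by rewrite nth_default.
have Es : (size (val E) <= n.+1)%N.
  by apply: leq_trans (size_npoly E) _; rewrite [X in (X.-1 <= _)%N]size_h.
by have := leq_trans iE (leq_trans Es iP); rewrite ltnn.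
Qed.

Lemma model_basis : bijective comb.
Proof.
exists coefQ => [c|E]; last exact: comb_coef.
by apply/funext => i; rewrite coef_comb.
Qed.

Definition model_chi (E F : Q) : int :=
  \sum_(i < n.+1) \sum_(j < n.+1) coefQ E i * coefQ F j * 'C(n + j - i, n)%:Z.

Lemma model_chiDl E E' F : model_chi (E + E') F = model_chi E F + model_chi E' F.
Proof.
rewrite /model_chi -big_split; apply: eq_bigr => i _.
by rewrite -big_split; apply: eq_bigr => j _; rewrite coefQD !mulrDl.
Qed.

Lemma model_chiDr E F F' : model_chi E (F + F') = model_chi E F + model_chi E F'.
Proof.
rewrite /model_chi -big_split; apply: eq_bigr => i _.
by rewrite -big_split; apply: eq_bigr => j _; rewrite coefQD mulrDr mulrDl.
Qed.

Let model_chi_basis (i j : nat) : (i < n.+1)%N -> (j < n.+1)%N ->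
  model_chi (model_O i%:Z) (model_O j%:Z) = 'C(n + j - i, n)%:Z.
Proof.
move=> iP jP.
have cE a (b : 'I_n.+1) : (a < n.+1)%N -> coefQ (model_O a%:Z) b = (b == a :> nat)%:R.
  by move=> aP; rewrite /coefQ (model_O_coef (Ordinal aP)) coefXn.
move: (model_O i%:Z) (model_O j%:Z) (cE i ^~ iP) (cE j ^~ jP) => E F EE FE.
rewrite /model_chi (bigD1 (Ordinal iP)) //= [X in _ + X]big1 ?addr0 => [|a ai].
  rewrite (bigD1 (Ordinal jP)) //= [X in _ + X]big1 ?addr0 => [|b bj].
    by rewrite EE FE !eqxx !mul1r.
  rewrite FE; case: eqP => [e|_]; last by rewrite mulr0 mul0r.
  by case/eqP: bj; apply: val_inj.
apply: big1 => b _; rewrite EE; case: eqP => [e|_]; last by rewrite !mul0r.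
by case/eqP: ai; apply: val_inj.
Qed.

Let diff_additive N (l : Q -> int) k :
    (forall E F, l (E + F) = l E + l F) ->
  iter N diff (fun k => (l (model_O k))%:Q) k =
  (l ((x - 1) ^+ N * model_O k))%:Q.
Proof.
move=> lD; elim: N k => [|N IH] k; first by rewrite mul1r.
have lB E F : l (E - F) = l E - l F.
  by apply/eqP; rewrite eq_sym subr_eq -lD subrK.
rewrite iterS /diff -/diff !IH -rmorphB -lB; congr (l _)%:Q.
by rewrite model_OS exprS; ring.
Qed.

Let l0 (l : Q -> int) : (forall E F, l (E + F) = l E + l F) -> l 0 = 0.
Proof. by move=> lD; apply: (addrI (l 0)); rewrite -lD !addr0. Qed.

Lemma model_chi_O k m :
  (model_chi (model_O k) (model_O m))%:Q = binq (n%:Z + m - k) n.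
Proof.
apply/eqP; rewrite -subr_eq0; apply/eqP; move: k.
apply: (@diff_uniq n.+1) => [k|i iP].
  rewrite diffB (@diff_additive _ (model_chi^~ (model_O m))); last first.
    by move=> E F; rewrite model_chiDl.
  rewrite diff_binql ltnn x1n mul0r (l0 (l := model_chi^~ (model_O m))) ?subr0 //.
  by move=> E F; rewrite model_chiDl.
move: m; apply: (@diff_uniq n.+1) => [m|j jP].
  rewrite diffB (@diff_additive _ (model_chi (model_O i))); last first.
    by move=> E F; rewrite model_chiDr.
  under [X in iter _ _ X]eq_fun do rewrite addrAC.
  rewrite diff_binqr ltnn x1n mul0r (l0 (l := model_chi (model_O i))) ?subr0 //.
  by move=> E F; rewrite model_chiDr.
rewrite model_chi_basis // (_ : n%:Z + j%:Z - i%:Z = (n + j - i)%N%:Z).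
  by rewrite binq_nat subrr.
by lia.
Qed.

Definition K0P_model : K0P n :=
  {| OO_basis := model_basis; OO_tensor := model_OD; chiDl := model_chiDl;
     chiDr := model_chiDr; chi_OO := model_chi_O |}.

End Model.

(* Main.v *)
Require Import Defs.
From HB Require Import structures.
From mathcomp Require Import all_boot all_order all_algebra.
From mathcomp Require Import all_classical all_reals topology normedtype derive.
From mathcomp Require Import ring lra zify.

Set Implicit Arguments.
Unset Strict Implicit.
Unset Printing Implicit Defensive.

Import Order.TTheory GRing.Theory Num.Theory.
Import numFieldNormedType.Exports.

Local Open Scope classical_set_scope.
Local Open Scope ring_scope.

(* By Serre duality an isometry commutes with the twist by O(-6); as this twist
   is unipotent and K is torsion-free, it commutes with the twist by O(1), hence
   is the multiplication by some a. For h = O - O(-1), which satisfies h^6 = 0,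
   the adjoint of the multiplication by h is that by h' = O - O(1), so a = a(h) is
   isometric iff a(h') a(h) = 1. Up to sign and a power of O(1) this says
   a = 1 + 2 j h^3 + 3 j h^4 + l h^5.
   The sign is detected by the identity component: the symmetrized form has a
   one-dimensional radical, spanned by the class h^5 of a point, so a real
   isometry scales h^5 by a nonzero factor. Conversely a unipotent isometry 1 + N
   lies on the path s |-> sum_m binom(s, m) N^m, which consists of isometries
   because this is a polynomial condition on s that holds for natural s. *)

Lemma binq_opp (x : int) n : binq (n%:Z - 1 - x) n = (-1) ^+ n * binq x n.
Proof.
rewrite /binq mulrA; congr (_ / _); rewrite (reindex_inj rev_ord_inj) /=.
rewrite -[n in (-1) ^+ n]card_ord -prodr_const -big_split /=.
apply: eq_bigr => i _; rewrite mulN1r -rmorphN; congr (_%:~R) => /=.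
by have := ltn_ord i; lia.
Qed.

Section EulerForm.
Variables (n : nat) (K : K0P n).
Local Notation O := (OO K).

Lemma OO_span (E : K) : exists c : 'I_n.+1 -> int, E = \sum_(i < n.+1) O i%:Z *~ c i.
Proof. by have [g _ gK] := OO_basis K; exists (g E). Qed.

Lemma OO_free (c d : 'I_n.+1 -> int) :
  \sum_(i < n.+1) O i%:Z *~ c i = \sum_(i < n.+1) O i%:Z *~ d i -> c = d.
Proof. exact: (bij_inj (OO_basis K)). Qed.

Lemma OO0 : O 0 = 1.
Proof.
have [c c1] := OO_span 1; rewrite -[O 0]mulr1 c1 mulr_sumr.
by apply: eq_bigr => i _; rewrite mulrzAr OO_tensor add0r.
Qed.

Lemma mulOOK k E : O k * (O (- k) * E) = E.
Proof. by rewrite mulrA OO_tensor subrr OO0 mul1r. Qed.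

Lemma OO_exp (m : nat) : O m%:Z = O 1 ^+ m.
Proof. by elim: m => [|m IH]; rewrite ?OO0 // exprS -IH OO_tensor; congr O; lia. Qed.

Lemma mulrz_eq0_K0 (E : K) (m : int) : m != 0 -> E *~ m = 0 -> E = 0.
Proof.
have [c ->] := OO_span E; move=> m0; rewrite mulrz_suml => h.
rewrite big1 // => i _; rewrite (_ : c i = 0) //.
have /(@OO_free (fun i => c i * m) (fun=> 0)) : \sum_(i < n.+1) O i%:Z *~ (c i * m) =
    \sum_(i < n.+1) O i%:Z *~ 0.
  rewrite [RHS]big1 // -[RHS]h.
  by apply: eq_bigr => j _; rewrite mulrzA.
move/(congr1 (fun d => d i)) => /=.
by move/eqP; rewrite mulf_eq0 (negPf m0) orbF => /eqP.
Qed.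

Lemma zmod_eq_OO (V : zmodType) (f g : K -> V) :
    zmod_morphism f -> zmod_morphism g ->
  (forall i : 'I_n.+1, f (O i%:Z) = g (O i%:Z)) -> f =1 g.
Proof.
move=> fB gB fg E; have [c ->] := OO_span E.
pose F : {additive K -> V} := HB.pack f (GRing.isZmodMorphism.Build K V f fB).
pose G : {additive K -> V} := HB.pack g (GRing.isZmodMorphism.Build K V g gB).
rewrite -[f _]/(F _) -[g _]/(G _) !raddf_sum; apply: eq_bigr => i _.
by rewrite !raddfMz /= fg.
Qed.

Lemma chi_zmodl F : zmod_morphism (chi K ^~ F).
Proof. by move=> E E'; apply: (addIr (chi K E' F)); rewrite -chiDl !subrK. Qed.

Lemma chi_zmodr E : zmod_morphism (chi K E).
Proof. by move=> F F'; apply: (addIr (chi K E F')); rewrite -chiDr !subrK. Qed.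

Lemma chi_sumr E m (F : 'I_m -> K) (c : 'I_m -> int) :
  chi K E (\sum_(i < m) F i *~ c i) = \sum_(i < m) c i * chi K E (F i).
Proof.
pose X : {additive K -> int} :=
  HB.pack (chi K E) (GRing.isZmodMorphism.Build K int _ (chi_zmodr E)).
rewrite -[LHS]/(X _) raddf_sum; apply: eq_bigr => i _.
by rewrite raddfMz -mulrzr intz mulrC.
Qed.

Lemma chi_suml F m (E : 'I_m -> K) (c : 'I_m -> int) :
  chi K (\sum_(i < m) E i *~ c i) F = \sum_(i < m) c i * chi K (E i) F.
Proof.
pose X : {additive K -> int} :=
  HB.pack (chi K ^~ F) (GRing.isZmodMorphism.Build K int _ (chi_zmodl F)).
rewrite -[LHS]/(X _) raddf_sum; apply: eq_bigr => i _.
by rewrite raddfMz -mulrzr intz mulrC.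
Qed.

Lemma chiMzr E F c : chi K E (F *~ c) = c * chi K E F.
Proof. by have := chi_sumr E (fun=> F) (fun _ : 'I_1 => c); rewrite !big_ord1. Qed.

Lemma chiMzl E F c : chi K (E *~ c) F = c * chi K E F.
Proof. by have := chi_suml F (fun=> E) (fun _ : 'I_1 => c); rewrite !big_ord1. Qed.

Lemma biadditive_eq_OO (V : zmodType) (f g : K -> K -> V) :
    (forall F, zmod_morphism (f ^~ F)) -> (forall E, zmod_morphism (f E)) ->
    (forall F, zmod_morphism (g ^~ F)) -> (forall E, zmod_morphism (g E)) ->
    (forall i j : 'I_n.+1, f (O i%:Z) (O j%:Z) = g (O i%:Z) (O j%:Z)) ->
  f =2 g.
Proof.
move=> fl fr gl gr fg E F; apply: (@zmod_eq_OO _ (f ^~ F) (g ^~ F)) => // i.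
by move: F; apply: (@zmod_eq_OO _ (f _) (g _)).
Qed.

Lemma chi_twist k E F : chi K (O k * E) (O k * F) = chi K E F.
Proof.
move: E F; apply: biadditive_eq_OO.
- by move=> F E E'; rewrite mulrBr chi_zmodl.
- by move=> E F F'; rewrite mulrBr chi_zmodr.
- exact: chi_zmodl.
- exact: chi_zmodr.
move=> i j; apply: (@intr_inj rat); rewrite !OO_tensor !chi_OO.
by congr binq; lia.
Qed.

Lemma chi_twist_adj k E F : chi K (O k * E) F = chi K E (O (- k) * F).
Proof. by rewrite -[in LHS](mulOOK k F) chi_twist. Qed.

Lemma serre_duality E F : chi K E F = (-1) ^+ n * chi K F (O (- n.+1%:Z) * E).
Proof.
move: E F; apply: biadditive_eq_OO.
- exact: chi_zmodl.
- exact: chi_zmodr.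
- by move=> F E E'; rewrite mulrBr chi_zmodr mulrBr.
- by move=> E F F'; rewrite chi_zmodl mulrBr.
move=> i j; apply: (@intr_inj rat); rewrite rmorphM rmorphXn rmorphN1 /=.
rewrite OO_tensor !chi_OO.
rewrite (_ : n%:Z + (- n.+1%:Z + i%:Z) - j%:Z = n%:Z - 1 - (n%:Z + j%:Z - i%:Z)).
  by rewrite binq_opp mulrA -signr_odd -expr2 sqrr_sign mul1r.
by lia.
Qed.

Lemma chi_OO_nat (i j : nat) : (i <= n)%N ->
  chi K (O i%:Z) (O j%:Z) = 'C(n + j - i, n)%:Z.
Proof.
move=> ni; apply: (@intr_inj rat); rewrite chi_OO -pmulrn -binq_nat.
by congr binq; lia.
Qed.

Lemma chi_nondegenerate F F' : (forall E, chi K E F = chi K E F') -> F = F'.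
Proof.
move=> FF'; apply/eqP; rewrite -subr_eq0; apply/eqP.
have {FF'}: forall i : 'I_n.+1, chi K (O i%:Z) (F - F') = 0.
  by move=> i; rewrite chi_zmodr FF' subrr.
have [c ->] := OO_span (F - F'); move=> h.
suff c0 (i : 'I_n.+1) : c i = 0 by rewrite big1 // => i _; rewrite c0.
have [m] := ubnP (n - i)%N; elim: m i => // m IHm i im.
have := h i; rewrite chi_sumr (bigD1 i) //= big1 ?addr0 => [|j ji].
  by rewrite chi_OO_nat 1?leq_ord // addnK binn mulr1.
have [ij|ij|/val_inj ij] := ltngtP i j.
- by rewrite IHm ?mul0r //; have := ltn_ord j; lia.
- rewrite chi_OO_nat 1?leq_ord // bin_small ?mulr0 //.
  by have := leq_ord i; lia.
- by rewrite ij eqxx in ji.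
Qed.

Lemma chi_OO_diff N k m :
  (chi K (O k) ((O 1 - 1) ^+ N * O m))%:Q =
  if (N <= n)%N then binq (n%:Z + m - k) (n - N) else 0.
Proof.
elim: N m => [|N IHN] m; first by rewrite mul1r chi_OO subn0.
rewrite exprSr -mulrA mulrBl mul1r OO_tensor mulrBr chi_zmodr rmorphB /= !IHN.
case: (ltngtP N n) => // [lt|->]; last by rewrite subnn /binq !big_ord0 subrr.
have -> : (n - N = (n - N.+1).+1)%N by lia.
by rewrite -[RHS]binqS; congr (binq _ _ - _); lia.
Qed.

Lemma OO1_unipotent : (O 1 - 1) ^+ n.+1 = 0.
Proof.
apply: chi_nondegenerate.
apply: (@zmod_eq_OO _ (chi K ^~ _) (chi K ^~ _)) => [||i]; [exact: chi_zmodl..|].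
rewrite -[0 in RHS](subrr 0) chi_zmodr subrr; apply: (@intr_inj rat).
by have := chi_OO_diff n.+1 i 0; rewrite ltnn OO0 mulr1.
Qed.

Lemma isometry_OO_comm f E : Isom f ->
  f (O (- n.+1%:Z) * E) = O (- n.+1%:Z) * f E.
Proof.
move=> [fB [g fK gK] fchi]; apply: chi_nondegenerate => F.
rewrite -[F]gK fchi; apply: (@mulfI _ ((-1) ^+ n)); first by rewrite signr_eq0.
by rewrite -!serre_duality fchi.
Qed.

End EulerForm.

Section Adjoint.
Variables (n : nat) (K : K0P n).

Definition chi_adjoint (a a' : K) :=
  forall E F, chi K (a * E) F = chi K E (a' * F).

Lemma chi_adjointD a a' b b' :
  chi_adjoint a a' -> chi_adjoint b b' -> chi_adjoint (a + b) (a' + b').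
Proof. by move=> aP bP E F; rewrite !mulrDl chiDl chiDr aP bP. Qed.

Lemma chi_adjointM a a' b b' :
  chi_adjoint a a' -> chi_adjoint b b' -> chi_adjoint (a * b) (a' * b').
Proof. by move=> aP bP E F; rewrite -mulrA aP bP mulrA [b' * _]mulrC. Qed.

Lemma chi_adjoint_int c : chi_adjoint c%:~R c%:~R.
Proof.
by move=> E F; rewrite !mulrzl chiMzl chiMzr.
Qed.

Lemma chi_adjoint1 : chi_adjoint 1 1.
Proof. by move=> E F; rewrite !mul1r. Qed.

Lemma chi_adjointX a a' m : chi_adjoint a a' -> chi_adjoint (a ^+ m) (a' ^+ m).
Proof.
move=> aP; elim: m => [|m IH]; first exact: chi_adjoint1.
by rewrite !exprS; apply: chi_adjointM.
Qed.

Lemma chi_adjoint_isometry a a' : chi_adjoint a a' ->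
  (forall E F, chi K (E * a) (F * a) = chi K E F) <-> a' * a = 1.
Proof.
move=> aP; split=> [ai|aa E F]; last first.
  by rewrite [E * a]mulrC [F * a]mulrC aP mulrA aa mul1r.
apply: chi_nondegenerate => E; have := ai E 1.
by rewrite [E * a]mulrC aP mul1r.
Qed.

End Adjoint.

Section CommutingMultiplications.
Variables (A : comNzRingType) (f : A -> A).
Hypothesis fB : zmod_morphism f.

Definition commutes_mul (u : A) := forall E, f (u * E) = u * f E.

Lemma commutes_mulM u v :
  commutes_mul u -> commutes_mul v -> commutes_mul (u * v).
Proof. by move=> uP vP E; rewrite -!mulrA uP vP. Qed.

Lemma commutes_mulX u m : commutes_mul u -> commutes_mul (u ^+ m).
Proof.
move=> uP; elim: m => [|m IH]; first by move=> E; rewrite !mul1r.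
by rewrite exprS; apply: commutes_mulM.
Qed.

Let F : {additive A -> A} := HB.pack f (GRing.isZmodMorphism.Build A A f fB).

Lemma commutes_mulD u v :
  commutes_mul u -> commutes_mul v -> commutes_mul (u + v).
Proof. by move=> uP vP E; rewrite !mulrDl -[LHS]/(F _) raddfD /= uP vP. Qed.

Lemma commutes_mulMz u (c : int) : commutes_mul u -> commutes_mul (u *~ c).
Proof. by move=> uP E; rewrite !mulrzAl -[LHS]/(F _) raddfMz /= uP. Qed.

End CommutingMultiplications.

Section P5.
Variable K : K0P 5.
Local Notation O := (OO K).

Definition hyp : K := 1 - O (-1).
Local Notation h := hyp.

Lemma OP_hyp m : OP K m = h ^+ (5 - m).
Proof. by rewrite /OP OO0. Qed.

Lemma hyp6 : h ^+ 6 = 0.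
Proof.
have -> : h = O (-1) * (O 1 - 1).
  by rewrite mulrBr OO_tensor mulr1 OO0.
by rewrite exprMn OO1_unipotent mulr0.
Qed.

Lemma OOm1 : O (-1) = 1 - h.
Proof. by rewrite /hyp subKr. Qed.

Lemma OO1E : O 1 = 1 + h + h ^+ 2 + h ^+ 3 + h ^+ 4 + h ^+ 5.
Proof.
have : O 1 * (1 - h) = 1 by rewrite -OOm1 OO_tensor OO0.
move/(congr1 ( *%R^~ (1 + h + h ^+ 2 + h ^+ 3 + h ^+ 4 + h ^+ 5))).
by rewrite mul1r => <-; ring: hyp6.
Qed.

Definition hcomb (a0 a1 a2 a3 a4 a5 : int) (u : K) : K :=
  a0%:~R + a1%:~R * u + a2%:~R * u ^+ 2 + a3%:~R * u ^+ 3 + a4%:~R * u ^+ 4 +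
  a5%:~R * u ^+ 5.

Lemma hcomb_span E : exists a0 a1 a2 a3 a4 a5, E = hcomb a0 a1 a2 a3 a4 a5 h.
Proof.
have [c ->] := OO_span E.
under eq_bigr do rewrite OO_exp OO1E.
rewrite !big_ord_recl big_ord0 /=.
move: (c _) (c _) (c _) (c _) (c _) (c _) => c5 c4 c3 c2 c1 c0.
exists (c0 + c1 + c2 + c3 + c4 + c5), (c1 + 2 * c2 + 3 * c3 + 4 * c4 + 5 * c5),
  (c1 + 3 * c2 + 6 * c3 + 10 * c4 + 15 * c5),
  (c1 + 4 * c2 + 10 * c3 + 20 * c4 + 35 * c5),
  (c1 + 5 * c2 + 15 * c3 + 35 * c4 + 70 * c5),
  (c1 + 6 * c2 + 21 * c3 + 56 * c4 + 126 * c5).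
by rewrite /hcomb; ring: hyp6.
Qed.

Lemma hyp5_free (c d : int) : c%:~R * h ^+ 5 = d%:~R * h ^+ 5 -> c = d.
Proof.
have h5 : chi K (O 0) (h ^+ 5) = 1.
  have -> : h ^+ 5 = (O 1 - 1) ^+ 5 * O (-5).
    rewrite (_ : O (-5) = O (-1) ^+ 5); last by rewrite !exprS expr0 mulr1 !OO_tensor.
    by rewrite -exprMn mulrBl OO_tensor mul1r OO0.
  by apply: (@intr_inj rat); rewrite chi_OO_diff /= /binq big_ord0 fact0 divr1.
move=> /(congr1 (chi K (O 0))).
by rewrite !mulrzl !chiMzr h5 !mulr1.
Qed.

Lemma hcomb_eq0 a0 a1 a2 a3 a4 a5 : hcomb a0 a1 a2 a3 a4 a5 h = 0 ->
  [/\ a0 = 0, a1 = 0 & [/\ a2 = 0, a3 = 0, a4 = 0 & a5 = 0]].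
Proof.
rewrite /hcomb => e.
have step c : c%:~R * h ^+ 5 = 0 -> c = 0.
  by move=> c0; apply: hyp5_free; rewrite c0 mul0r.
have z0 : a0 = 0.
  apply: step; have := congr1 ( *%R (h ^+ 5)) e.
  by rewrite mulr0 => <-; ring: hyp6.
subst a0; have z1 : a1 = 0.
  apply: step; have := congr1 ( *%R (h ^+ 4)) e.
  by rewrite mulr0 => <-; ring: hyp6.
subst a1; have z2 : a2 = 0.
  apply: step; have := congr1 ( *%R (h ^+ 3)) e.
  by rewrite mulr0 => <-; ring: hyp6.
subst a2; have z3 : a3 = 0.
  apply: step; have := congr1 ( *%R (h ^+ 2)) e.
  by rewrite mulr0 => <-; ring: hyp6.
subst a3; have z4 : a4 = 0.
  apply: step; have := congr1 ( *%R h) e.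
  by rewrite mulr0 => <-; ring: hyp6.
subst a4; have z5 : a5 = 0.
  by apply: step; rewrite -e; ring.
by [].
Qed.

Lemma hyp_adjoint : chi_adjoint h (1 - O 1).
Proof.
by move=> E F; rewrite !mulrBl !mul1r chi_zmodl chi_zmodr chi_twist_adj opprK.
Qed.

Definition hyp' : K := - (h + h ^+ 2 + h ^+ 3 + h ^+ 4 + h ^+ 5).

Lemma hcomb_adjoint a0 a1 a2 a3 a4 a5 :
  chi_adjoint (hcomb a0 a1 a2 a3 a4 a5 h) (hcomb a0 a1 a2 a3 a4 a5 hyp').
Proof.
have hP : chi_adjoint h hyp'.
  by rewrite (_ : hyp' = 1 - O 1); [exact: hyp_adjoint|rewrite OO1E /hyp'; ring].
have cP c m : chi_adjoint (c%:~R * h ^+ m) (c%:~R * hyp' ^+ m).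
  by apply: chi_adjointM; [exact: chi_adjoint_int|exact: chi_adjointX].
do !apply: chi_adjointD; try exact: cP; first exact: chi_adjoint_int.
exact: (cP _ 1%N).
Qed.

Lemma OO_mul_hyp4 i : O i * h ^+ 4 = h ^+ 4 + i%:~R * h ^+ 5.
Proof.
elim/int_rec: i => [|m IH|m IH]; first by rewrite OO0 mul1r mul0r addr0.
- rewrite (_ : m.+1%:Z = 1 + m%:Z); last by lia.
  by rewrite -OO_tensor -mulrA IH OO1E; ring: hyp6.
- rewrite (_ : - m.+1%:Z = -1 + - m%:Z); last by lia.
  by rewrite -OO_tensor -mulrA IH OOm1; ring: hyp6.
Qed.

(* the product of the i-th, j-th and k-th powers of the three generators *)
Definition gen (i j k : int) : K :=
  O i * hcomb 1 0 0 (2 * j) (3 * j) (4 * j + k) h.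

Lemma genD i j k i' j' k' :
  gen (i + i') (j + j') (k + k') = gen i j k * gen i' j' k'.
Proof. by rewrite /gen -OO_tensor /hcomb; ring: hyp6. Qed.

Lemma gen0 : gen 0 0 0 = 1.
Proof. by rewrite /gen OO0 /hcomb; ring. Qed.

Lemma gen_eq1 i j k : gen i j k = 1 -> [/\ i = 0, j = 0 & k = 0].
Proof.
move=> g1.
have i0 : i = 0.
  have := congr1 ( *%R^~ (h ^+ 4)) g1; rewrite /= /gen mulrAC OO_mul_hyp4 mul1r.
  rewrite (_ : _ * _ = h ^+ 4 + i%:~R * h ^+ 5); last by rewrite /hcomb; ring: hyp6.
  by move/(canRL (addKr _)); rewrite addNr => e; apply: hyp5_free; rewrite e mul0r.
subst i; move: g1; rewrite /gen OO0 mul1r => /eqP; rewrite -subr_eq0 => /eqP g1.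
have [] := @hcomb_eq0 0 0 0 (2 * j) (3 * j) (4 * j + k).
  by rewrite -[RHS]g1 /hcomb; ring.
by move=> _ _ [_ j0 _ k0]; split; lia.
Qed.

Lemma isometry_tensor (f : K -> K) : Isom f -> f = tensor (f 1).
Proof.
move=> fI; have [fB _ _] := fI.
have wP : commutes_mul f (O (-1) ^+ 6).
  move=> E; rewrite (_ : O (-1) ^+ 6 = O (- 6%:Z)); first exact: isometry_OO_comm.
  by rewrite !exprS expr0 mulr1 !OO_tensor.
have polyP u a0 a1 a2 a3 a4 a5 : commutes_mul f u ->
    commutes_mul f (hcomb a0 a1 a2 a3 a4 a5 (u - 1)).
  move=> uP; have c1 : commutes_mul f 1 by move=> E; rewrite !mul1r.
  have cP c m : commutes_mul f (c%:~R * (u - 1) ^+ m).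
    apply: commutes_mulM; first exact: commutes_mulMz.
    apply: commutes_mulX; apply: commutes_mulD => //.
    by rewrite -mulrN1z; apply: commutes_mulMz.
  rewrite /hcomb; do !apply: commutes_mulD => //; try exact: cP.
    exact: commutes_mulMz.
  exact: (cP _ 1%N).
have rootP u c : c != 0 -> commutes_mul f (u *~ c) -> commutes_mul f u.
  move=> c0 cP E; apply/eqP; rewrite -subr_eq0; apply/eqP.
  apply: (mulrz_eq0_K0 c0).
  pose F : {additive K -> K} := HB.pack f (GRing.isZmodMorphism.Build K K f fB).
  have := cP E; rewrite !mulrzAl -[LHS]/(F _) raddfMz /= => e.
  by rewrite mulrzBl e subrr.
(* truncated binomial series of the square root and of the cube root *)
have z3P : commutes_mul f (O (-1) ^+ 3).
  apply: (@rootP _ 256) => //.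
  rewrite (_ : _ *~ _ = hcomb 256 128 (-32) 16 (-10) 7 (O (-1) ^+ 6 - 1)).
    exact: polyP.
  by rewrite OOm1 /hcomb; ring: hyp6.
have zP : commutes_mul f (O (-1)).
  apply: (@rootP _ 729) => //.
  rewrite (_ : _ *~ _ = hcomb 729 243 (-81) 45 (-30) 22 (O (-1) ^+ 3 - 1)).
    exact: polyP.
  by rewrite OOm1 /hcomb; ring: hyp6.
have xP : commutes_mul f (O 1).
  move=> E; have := zP (O 1 * E).
  by rewrite mulrA OO_tensor addNr OO0 mul1r => ->; rewrite (mulOOK 1).
apply/funext => E; rewrite /tensor.
move: E; apply: (zmod_eq_OO fB) => [E E'|i]; first by rewrite mulrBl.
by rewrite OO_exp -(commutes_mulX i xP) mulr1.
Qed.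

Definition chi_unitary (a : K) :=
  forall E F, chi K (E * a) (F * a) = chi K E F.

Lemma chi_unitary_hcombP a0 a1 a2 a3 a4 a5 :
  chi_unitary (hcomb a0 a1 a2 a3 a4 a5 h) <->
  hcomb a0 a1 a2 a3 a4 a5 hyp' * hcomb a0 a1 a2 a3 a4 a5 h = 1.
Proof. exact/chi_adjoint_isometry/hcomb_adjoint. Qed.

Lemma chi_unitaryM a b : chi_unitary a -> chi_unitary b -> chi_unitary (a * b).
Proof. by move=> aP bP E F; rewrite !mulrA bP aP. Qed.

Lemma chi_unitary_OO i : chi_unitary (O i).
Proof. by move=> E F; rewrite ![_ * O i]mulrC chi_twist. Qed.

Lemma chi_unitary_gen i j k : chi_unitary (gen i j k).
Proof.
apply: chi_unitaryM; first exact: chi_unitary_OO.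
by apply/chi_unitary_hcombP; rewrite /hcomb /hyp'; ring: hyp6.
Qed.

Lemma chi_unitary_hcomb10 a2 a3 a4 a5 : chi_unitary (hcomb 1 0 a2 a3 a4 a5 h) ->
  exists j k, hcomb 1 0 a2 a3 a4 a5 h = gen 0 j k.
Proof.
move/chi_unitary_hcombP=> e.
have a20 : 2 * a2 = 0.
  apply: hyp5_free; apply: (addrI (h ^+ 3)); rewrite mul0r addr0 -[RHS]mulr1 -[in RHS]e.
  by rewrite /hcomb /hyp'; ring: hyp6.
have {}a20 : a2 = 0 by lia.
subst a2.
have a34 : 2 * a4 - 3 * a3 = 0.
  apply: hyp5_free; apply: (addrI h); rewrite mul0r addr0 -[RHS]mulr1 -[in RHS]e.
  by rewrite /hcomb /hyp'; ring: hyp6.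
exists (a4 - a3), (a5 - 4 * (a4 - a3)).
rewrite /gen OO0 mul1r; congr hcomb; lia.
Qed.

Lemma chi_unitary_hcomb1 a1 a2 a3 a4 a5 : chi_unitary (hcomb 1 a1 a2 a3 a4 a5 h) ->
  exists i j k, hcomb 1 a1 a2 a3 a4 a5 h = gen i j k.
Proof.
set a := hcomb _ _ _ _ _ _ _ => aU.
have := chi_unitaryM aU (chi_unitary_OO (- a1)).
have [b0 [b1 [b2 [b3 [b4 [b5 bE]]]]]] := hcomb_span (a * O (- a1)).
have [] := @hcomb_eq0 0 0 0 0 (b0 - 1) b1.
  have := congr1 ( *%R^~ (h ^+ 4)) bE; rewrite /= -mulrA OO_mul_hyp4 => e.
  transitivity (hcomb b0 b1 b2 b3 b4 b5 h * h ^+ 4 - h ^+ 4).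
    by rewrite /hcomb; ring: hyp6.
  by rewrite -e /a /hcomb; ring: hyp6.
move=> _ _ [_ _ b01 b10]; have {}b01 : b0 = 1 by lia.
subst b0 b1; rewrite bE => /chi_unitary_hcomb10 [j [k bg]].
exists a1, j, k; rewrite -[a](mulOOK a1) [O (- a1) * _]mulrC bE bg.
by rewrite /gen OO0 mul1r.
Qed.

Lemma chi_unitaryP a : chi_unitary a ->
  exists i j k, a = gen i j k \/ a = - gen i j k.
Proof.
have [a0 [a1 [a2 [a3 [a4 [a5 ->]]]]]] := hcomb_span a; move=> aU.
have [a01|a01] : a0 = 1 \/ a0 = -1.
  have /chi_unitary_hcombP e := aU.
  have : a0 * a0 = 1.
    apply: hyp5_free; rewrite mul1r -[RHS]mulr1 -[in RHS]e.
    by rewrite /hcomb /hyp'; ring: hyp6.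
  by nia.
- subst a0; have [i [j [k ->]]] := chi_unitary_hcomb1 aU.
  by exists i, j, k; left.
- subst a0; have [] := @chi_unitary_hcomb1 (- a1) (- a2) (- a3) (- a4) (- a5).
    rewrite (_ : hcomb _ _ _ _ _ _ _ = hcomb (-1) a1 a2 a3 a4 a5 h * (-1)%:~R).
      apply: chi_unitaryM => //.
      by apply/(chi_adjoint_isometry (@chi_adjoint_int _ K (-1))); ring.
    by rewrite /hcomb; ring.
  move=> i [j [k e]]; exists i, j, k; right; rewrite -e /hcomb; ring.
Qed.

Lemma isometry_gen (f : K -> K) : Isom f ->
  exists i j k, f = tensor (gen i j k) \/ f = tensor (- gen i j k).
Proof.
move=> fI; have [_ _ fchi] := fI; rewrite (isometry_tensor fI) in fchi *.
have [i [j [k ijk]]] := chi_unitaryP fchi.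
by exists i, j, k; case: ijk => ->; [left|right].
Qed.

Lemma Isom_gen i j k : Isom (tensor (gen i j k)).
Proof.
split=> [E F||]; [exact: mulrBl| |exact: chi_unitary_gen].
exists (tensor (gen (- i) (- j) (- k))) => E; rewrite /tensor -mulrA -genD.
  by rewrite !subrr gen0 mulr1.
by rewrite !addNr gen0 mulr1.
Qed.

End P5.

Section BinomialPolynomial.
Variable F : numFieldType.

Definition binp (m : nat) : {poly F} :=
  (m`!%:R)^-1 *: \prod_(i < m) ('X - (i%:R)%:P).

Lemma binp_nat m t : (binp m).[t%:R] = 'C(t, m)%:R.
Proof.
have e : \prod_(i < m) (t%:R - i%:R) = (t ^_ m)%:R :> F.
  elim: m => [|m IH]; first by rewrite big_ord0.
  rewrite big_ord_recr /= IH ffactnSr natrM.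
  have [mt|tm] := leqP m t; first by rewrite natrB.
  by rewrite ffact_small // !mul0r.
rewrite hornerZ horner_prod; under eq_bigr do rewrite hornerXsubC.
by rewrite e -bin_ffact natrM mulrC mulfK // pnatr_eq0 -lt0n fact_gt0.
Qed.

Lemma poly_nat_eq0 (p : {poly F}) : (forall t : nat, p.[t%:R] = 0) -> p = 0.
Proof.
move=> p0; apply/eqP; apply: contraT => pn0.
have := @max_poly_roots _ p [seq t%:R | t <- iota 0 (size p)] pn0.
rewrite size_map size_iota ltnn; apply.
  by apply/allP => _ /mapP[t _ ->]; apply/rootP.
by rewrite map_inj_uniq ?iota_uniq // => i j /eqP; rewrite eqr_nat => /eqP.
Qed.

End BinomialPolynomial.

Section UnipotentPath.
Variables (R : realType) (n : nat).
Implicit Types (N G : 'M[R]_n.+1).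

Definition upath N k (s : R) : 'M[R]_n.+1 := \sum_(m < k) (binp R m).[s] *: N ^+ m.

Lemma upath_nat N k t : N ^+ k = 0 -> upath N k t%:R = (1 + N) ^+ t.
Proof.
move=> Nk; rewrite addrC exprD1n /upath.
under eq_bigr do rewrite binp_nat scaler_nat.
rewrite (big_ord_widen (k + t.+1) (fun m => N ^+ m *+ 'C(t, m))) ?leq_addr //.
rewrite (big_ord_widen (k + t.+1) (fun m => N ^+ m *+ 'C(t, m))) ?leq_addl //.
rewrite big_mkcond [RHS]big_mkcond; apply: eq_bigr => m _.
case: ltnP => km; case: ltnP => tm //.
  by rewrite bin_small.
by rewrite -(subnKC km) exprD Nk mul0r mul0rn.
Qed.

Lemma upath_continuous N k : continuous (upath N k).
Proof.
apply: continuous_big => [|m _ s]; first exact: add_continuous.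
by apply: cvgZr_tmp; exact: continuous_horner.
Qed.

(* both sides are polynomial in s and agree at the natural numbers *)
Lemma upath_preserves N k G s : N ^+ k = 0 ->
  (1 + N)^T *m G *m (1 + N) = G -> (upath N k s)^T *m G *m upath N k s = G.
Proof.
move=> Nk NG.
pose P : 'M[{poly R}]_n.+1 := \sum_(m < k) binp R m *: map_mx polyC (N ^+ m).
have PE s' : map_mx (horner_eval s') P = upath N k s'.
  rewrite /P /upath raddf_sum; apply: eq_bigr => m _.
  by apply/matrixP => i j; rewrite !mxE /= /horner_eval hornerM hornerC.
pose Q := P^T *m map_mx polyC G *m P - map_mx polyC G.
have QE s' : map_mx (horner_eval s') Q =
    (upath N k s')^T *m G *m upath N k s' - G.
  rewrite /Q map_mxB !map_mxM -map_trmx PE -map_mx_comp.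
  rewrite (_ : map_mx _ G = G) //.
  by apply/matrixP => i j; rewrite !mxE /= /horner_eval hornerC.
suff Q0 : Q = 0 by apply/eqP; rewrite -subr_eq0 -QE Q0 map_mx0.
apply/matrixP => i j; rewrite [RHS]mxE; apply: poly_nat_eq0 => t.
have := QE t%:R; move/matrixP/(_ i j); rewrite mxE /horner_eval => ->.
rewrite upath_nat // (_ : _ *m _ = G) ?subrr ?mxE //.
elim: t => [|t IH]; first by rewrite trmx1 mul1mx mulmx1.
by rewrite exprSr -mulmxE trmx_mul -[RHS]NG -[in RHS]IH !mulmxA.
Qed.

Lemma connected_setT_real : connected [set: R].
Proof. by apply/connected_intervalP => x y _ _ z _. Qed.

End UnipotentPath.

Section RealIsometries.
Variables (R : realType) (n : nat) (K : K0P n).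
Local Notation O := (OO K).

Definition gram : 'M[int]_n.+1 := \matrix_(i, j) chi K (O i%:Z) (O j%:Z).

Definition gramR : 'M[R]_n.+1 := map_mx intr gram.

Lemma chiRE (u v : 'cV[R]_n.+1) : chiR K u v = (u^T *m gramR *m v) 0 0.
Proof.
rewrite mxE; under [RHS]eq_bigr do rewrite mxE mulr_suml.
rewrite exchange_big; apply: eq_bigr => i _; apply: eq_bigr => j _.
by rewrite !mxE mulrAC.
Qed.

Lemma det_gramR : \det gramR = 1.
Proof.
rewrite -det_tr det_trig.
  apply: big1 => i _; rewrite !mxE chi_OO_nat ?leq_ord //.
  by rewrite addnK binn.
apply/is_trig_mxP => i j ij; rewrite !mxE chi_OO_nat ?leq_ord //.
by rewrite bin_small //; have := leq_ord j; lia.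
Qed.

Lemma IsomRP (A : 'M[R]_n.+1) : IsomR K A <-> A^T *m gramR *m A = gramR.
Proof.
split=> [[_ Ai]|AG].
  apply/matrixP => i j.
  have entry (M : 'M[R]_n.+1) :
      M i j = ((delta_mx i (0 : 'I_1))^T *m M *m delta_mx j (0 : 'I_1)) 0 0.
    by rewrite trmx_delta -rowE -colE !mxE.
  by have := Ai (delta_mx i 0) (delta_mx j 0);
    rewrite !entry !chiRE trmx_mul !mulmxA.
split=> [|u v]; last first.
  by rewrite !chiRE trmx_mul -[in RHS]AG !mulmxA.
rewrite unitmxE unitfE; apply/eqP => dA; have := congr1 determinant AG.
by rewrite !det_mulmx dA mulr0 det_gramR => /esym/eqP; rewrite oner_eq0.
Qed.

Lemma Isom_matrix (f : K -> K) A : Isom f -> matrix_of f A ->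
  IsomR K (map_mx intr A : 'M[R]_n.+1).
Proof.
move=> [_ _ fchi] fA; apply/IsomRP.
rewrite map_trmx -!map_mxM; congr map_mx; apply/matrixP => i j.
rewrite [RHS]mxE -fchi !fA chi_suml !mxE; under [RHS]eq_bigr do rewrite chi_sumr mulr_sumr.
under [LHS]eq_bigr do rewrite mxE mulr_suml.
rewrite exchange_big; apply: eq_bigr => k _; apply: eq_bigr => l _.
by rewrite !mxE; ring.
Qed.

Lemma unipotent_IsomR_e (N : 'M[R]_n.+1) k : N ^+ k = 0 ->
  IsomR K (1 + N) -> IsomR_e K (1 + N).
Proof.
move=> Nk /IsomRP NG.
have conP : connected (upath N k @` setT).
  apply: connected_continuous_connected; first exact: connected_setT_real.
  exact/continuous_subspaceT/upath_continuous.
have := @connected_component_max _ (IsomR K) _ 1%:M _ _ conP; apply.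
- by exists 0 => //; rewrite -[0]/(0%:R) upath_nat.
- by move=> _ [s _ <-]; apply/IsomRP/upath_preserves.
- by exists 1 => //; rewrite -[1]/(1%:R) upath_nat.
Qed.

Lemma matrix_of_exists (f : K -> K) : exists A, matrix_of f A.
Proof.
have [g _ gK] := OO_basis K.
exists (\matrix_(i, j) g (f (O j%:Z)) i) => j; rewrite -[LHS]gK.
by apply: eq_bigr => i _; rewrite mxE.
Qed.

Lemma matrix_of_inj (f : K -> K) A B : matrix_of f A -> matrix_of f B -> A = B.
Proof.
move=> fA fB; apply/matrixP => i j.
have /OO_free/(congr1 (fun c => c i)) : \sum_(i < n.+1) O i%:Z *~ A i j =
  \sum_(i < n.+1) O i%:Z *~ B i j by rewrite -fA -fB.
exact.
Qed.

Lemma matrix_of_sum (a : K) A (c : 'I_n.+1 -> int) : matrix_of (tensor a) A ->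
  (\sum_(j < n.+1) O j%:Z *~ c j) * a =
  \sum_(i < n.+1) O i%:Z *~ (\sum_(j < n.+1) A i j * c j).
Proof.
move=> aA; rewrite mulr_suml.
under eq_bigr => j _ do rewrite mulrzAl -[O _ * a]/(tensor a _) aA mulrz_suml.
rewrite exchange_big; apply: eq_bigr => i _ /=; rewrite mulrz_sumr.
by apply: eq_bigr => j _; rewrite mulrzA.
Qed.

Lemma matrix_ofM (a b : K) A B : matrix_of (tensor a) A -> matrix_of (tensor b) B ->
  matrix_of (tensor (b * a)) (A *m B).
Proof.
move=> aA bB j; rewrite /tensor mulrA -[O _ * b]/(tensor b _) bB.
by rewrite (matrix_of_sum _ aA); apply: eq_bigr => i _; rewrite mxE.
Qed.

Lemma matrix_of1 : matrix_of (@tensor n K 1) 1%:M.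
Proof.
move=> j; rewrite (bigD1 j) //= big1 ?addr0 => [|i ij].
  by rewrite mxE eqxx /tensor mulr1.
by rewrite mxE (negPf ij).
Qed.

Lemma matrix_of0 : matrix_of (@tensor n K 0) 0.
Proof.
move=> j; rewrite big1 => [|i _]; first exact: mulr0.
by rewrite mxE.
Qed.

Lemma matrix_ofB (a b : K) A B : matrix_of (tensor a) A -> matrix_of (tensor b) B ->
  matrix_of (tensor (a - b)) (A - B).
Proof.
move=> aA bB j; have := aA j; have := bB j; rewrite /tensor mulrBr => -> ->.
by rewrite -sumrB; apply: eq_bigr => i _; rewrite !mxE mulrzBr.
Qed.

Lemma unipotent_Isom_e (a : K) k : Isom (tensor a) -> (a - 1) ^+ k = 0 ->
  Isom_e R K (tensor a).
Proof.
move=> aI ak; split=> //; have [A aA] := matrix_of_exists (tensor a).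
exists A => //; have := Isom_matrix aI aA.
have NP : matrix_of (tensor ((a - 1) ^+ k)) ((A - 1) ^+ k).
  have N1 := matrix_ofB aA matrix_of1.
  elim: (k) => [|m IH]; first exact: matrix_of1.
  by rewrite exprSr [in X in matrix_of _ X]exprS; apply: matrix_ofM.
have : (A - 1) ^+ k = 0 by apply: (matrix_of_inj NP); rewrite ak; exact: matrix_of0.
move/(congr1 (map_mx (intr : int -> R))); rewrite rmorphXn raddf0 => Nk.
rewrite (_ : map_mx intr A = 1 + map_mx intr (A - 1)).
  exact: (unipotent_IsomR_e Nk).
by rewrite map_mxB map_mx1 addrC subrK.
Qed.

End RealIsometries.

Section IdentityComponent.
Variables (R : realType) (K : K0P 5).
Local Notation O := (OO K).

(* the coordinates of (O(1) - O)^5, the class of a point *)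
Definition point_coord (i : 'I_6) : int := nth 0 [:: -1; 5; -10; 10; -5; 1] i.

Definition pointR : 'cV[R]_6 := \col_i (point_coord i)%:~R.

Lemma point_coordE : \sum_(i < 6) O i%:Z *~ point_coord i = hyp K ^+ 5.
Proof.
under eq_bigr do rewrite OO_exp OO1E.
rewrite !big_ord_recl big_ord0 /point_coord /bump /=.
by ring: (hyp6 K).
Qed.

Lemma gram_symE (i j : 'I_6) :
  gram K i j + gram K j i = ('C(5 + j - i, 5) + 'C(5 + i - j, 5))%N%:Z.
Proof. by rewrite !mxE !chi_OO_nat ?leq_ord. Qed.

Lemma gram_sym_mul (u : 'cV[R]_6) (i : 'I_6) :
  ((gramR R K + (gramR R K)^T) *m u) i 0 =
  \sum_(j < 6) ('C(5 + j - i, 5) + 'C(5 + i - j, 5))%N%:R * u j 0.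
Proof.
rewrite mxE; apply: eq_bigr => j _; congr (_ * _).
by rewrite -[RHS]/((Posz _)%:~R) -gram_symE !mxE rmorphD.
Qed.

Lemma pointR_radical : (gramR R K + (gramR R K)^T) *m pointR = 0.
Proof.
apply/matrixP => i j; rewrite ord1 gram_sym_mul mxE.
rewrite !big_ord_recl big_ord0 !mxE /point_coord /bump /=.
by case: i => [[|[|[|[|[|[|//]]]]]] /= _]; rewrite /binomial /=; lra.
Qed.

Lemma gram_sym_radical (u : 'cV[R]_6) :
  (gramR R K + (gramR R K)^T) *m u = 0 -> u ord_max 0 = 0 -> u = 0.
Proof.
move=> Su u5; pose x k := u (inord k) 0.
have xE j : u j 0 = x j by rewrite /x inord_val.
have {Su} e k : (k < 6)%N ->
    \sum_(j < 6) ('C(5 + j - k, 5) + 'C(5 + k - j, 5))%N%:R * x j = 0.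
  move=> k6; have := gram_sym_mul u (Ordinal k6); rewrite Su mxE => e; rewrite [RHS]e.
  by apply: eq_bigr => j _; rewrite xE.
rewrite xE /= in u5.
have := (e 0%N isT, e 1%N isT, e 2%N isT, e 3%N isT, e 4%N isT).
rewrite !big_ord_recl !big_ord0 /bump /= /binomial /= => -[[[[e0 e1] e2] e3] e4].
apply/matrixP => i j; rewrite ord1 xE mxE.
case: i => [[|[|[|[|[|[|//]]]]]] /= _] //; lra.
Qed.

Lemma IsomR_point_neq0 B : IsomR K B -> (B *m pointR) ord_max 0 != 0.
Proof.
move=> BI; have [Bu _] := BI; have /IsomRP BG := BI.
have BS : B^T *m (gramR R K + (gramR R K)^T) *m B = gramR R K + (gramR R K)^T.
  rewrite mulmxDr mulmxDl BG; congr (_ + _).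
  by rewrite -[in RHS]BG !trmx_mul trmxK mulmxA.
apply/eqP => /gram_sym_radical Bp.
have /(congr1 (mulmx (invmx B))) : B *m pointR = 0.
  apply: Bp; have : B^T *m ((gramR R K + (gramR R K)^T) *m (B *m pointR)) = 0.
    by rewrite mulmxA mulmxA BS pointR_radical.
  by move/(congr1 (mulmx (invmx B^T))); rewrite mulKmx ?unitmx_tr // mulmx0.
rewrite mulKmx // mulmx0 => /matrixP/(_ ord_max 0).
by rewrite !mxE /point_coord /= => /eqP; rewrite oner_eq0.
Qed.

(* the image of the component under [B |-> (B *m pointR) ord_max 0] is an
   interval containing 1 and avoiding 0 *)
Lemma IsomR_e_point_gt0 B : IsomR_e K B -> 0 < (B *m pointR) ord_max 0.
Proof.
pose phi (B : 'M[R]_6) : R := (B *m pointR) ord_max 0.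
move=> BI; rewrite -/(phi B).
have phic : continuous phi.
  rewrite (_ : phi = fun B => \sum_j B ord_max j * pointR j 0); last first.
    by apply/funext => A; rewrite /phi mxE.
  have mulc (T : topologicalType) (f : T -> R) (a : R) :
      continuous f -> continuous (fun x => f x * a).
    by move=> fc x; apply: cvgM; [exact: fc|exact: cvg_cst].
  apply: continuous_big => [|j _]; first exact: add_continuous.
  exact/mulc/coord_continuous.
have : connected (phi @` IsomR_e K).
  apply: connected_continuous_connected; first exact: component_connected.
  exact/continuous_subspaceT.
move/connected_intervalP => phiI; rewrite ltNge; apply/negP => B0.
have [C CI C0] : (phi @` IsomR_e K) 0.
  apply: (phiI (phi B) 1); first by exists B.
    exists 1%:M; last by rewrite /phi mul1mx !mxE.
    apply: connected_component_refl; apply/IsomRP.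
    by rewrite trmx1 mul1mx mulmx1.
  by rewrite B0 ler01.
have /IsomR_point_neq0 := connected_component_sub CI.
by rewrite -/(phi C) C0 eqxx.
Qed.

Lemma tensor_opp_gen_notin i j k : ~ Isom_e R K (tensor (- gen K i j k)).
Proof.
move=> [_ [A AP /IsomR_e_point_gt0]].
have := matrix_of_sum point_coord AP; rewrite point_coordE.
have -> : hyp K ^+ 5 * - gen K i j k = - (hyp K ^+ 5).
  rewrite mulrN /gen mulrA; congr (- _).
  have -> : hyp K ^+ 5 * O i = hyp K ^+ 5.
    by rewrite exprSr mulrAC [_ * O i]mulrC OO_mul_hyp4; ring: (hyp6 K).
  by rewrite /hcomb; ring: (hyp6 K).
rewrite -point_coordE -sumrN; under eq_bigr do rewrite -mulrNz.
move/(@OO_free _ K (fun i => - point_coord i)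
  (fun i => \sum_(j < 6) A i j * point_coord j)).
move/(congr1 (fun c => c ord_max)) => /= e.
have -> : (map_mx intr A *m pointR) ord_max 0 =
    (\sum_(j < 6) A ord_max j * point_coord j)%:~R.
  by rewrite mxE rmorph_sum; apply: eq_bigr => l _; rewrite !mxE rmorphM.
by rewrite -e ltr0z.
Qed.

Lemma gen_Isom_e i j k : Isom_e R K (tensor (gen K i j k)).
Proof.
apply: (@unipotent_Isom_e R 5 K _ 6); first exact: Isom_gen.
have [b0 [b1 [b2 [b3 [b4 [b5 bE]]]]]] := hcomb_span (gen K i j k).
have b01 : b0 = 1.
  apply: hyp5_free; rewrite mul1r.
  transitivity (gen K i j k * hyp K ^+ 5); first by rewrite bE /hcomb; ring: (hyp6 K).
  rewrite /gen mulrAC [in LHS]exprSr mulrA OO_mul_hyp4 /hcomb; ring: (hyp6 K).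
pose c := hcomb b1 b2 b3 b4 b5 0 (hyp K).
rewrite (_ : _ - 1 = hyp K * c); last by rewrite bE b01 /c /hcomb; ring.
by rewrite exprMn hyp6 mul0r.
Qed.

Lemma Isom_eE :
  Isom_e R K = [set tensor (gen K u.1.1 u.1.2 u.2) | u in [set: int * int * int]].
Proof.
apply/seteqP; split=> [f fe|_ [[[i j] k] _ <-]]; last exact: gen_Isom_e.
have [fI _] := fe; have [i [j [k [fE|fE]]]] := isometry_gen fI.
  by exists (i, j, k).
by case: (@tensor_opp_gen_notin i j k); rewrite -fE.
Qed.

End IdentityComponent.

Section OneParameter.
Variables (T : Type) (H : set (T -> T)) (p : int -> T -> T).
Hypotheses (HG : bij_group H) (p0 : p 0 = id).
Hypothesis pD : forall i j, p (i + j) = p i \o p j.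

Lemma bij_group_intpow : H (p 1) -> forall i, H (p i).
Proof.
have [Hid Hcomp Hinv] := HG; move=> H1.
have HN1 : H (p (-1)).
  have [g Hg [gK Kg]] := Hinv _ H1; rewrite (_ : p (-1) = g) //.
  apply/funext => x; rewrite -[in LHS](Kg x).
  by rewrite -[LHS]/((p (-1) \o p 1) _) -pD addNr p0.
elim/int_rec => [|m IH|m IH]; first by rewrite p0.
  by rewrite intS pD; apply: Hcomp.
by rewrite (_ : - m.+1%:Z = -1 + - m%:Z); [rewrite pD; apply: Hcomp|lia].
Qed.

End OneParameter.

Theorem proposition12 (R : realType) (K : K0P 5) :
  isomorphic_to_Zpow 3 (Isom_e R K) /\
  Isom_e R K =
    generated
      [set tensor (OO K 1);
           tensor (OO K 0 + OP K 2 *+ 2 + OP K 1 *+ 3 + OP K 0 *+ 4);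
           tensor (OO K 0 + OP K 0)].
Proof.
have tensorD (i j k i' j' k' : int) :
    tensor (gen K (i + i') (j + j') (k + k')) =
    tensor (gen K i j k) \o tensor (gen K i' j' k').
  by apply/funext => E; rewrite /tensor /= genD mulrCA mulrC mulrA mulrAC.
split.
  exists (fun u : 'rV[int]_3 => tensor (gen K (u 0 0) (u 0 1) (u 0 2))).
    by move=> u v; rewrite !mxE tensorD.
  rewrite Isom_eE; split=> [u _|u v _ _ uv|_ [[[i j] k] _ <-]].
  - by exists (u 0 0, u 0 1, u 0 2).
  - have : gen K (u 0 0) (u 0 1) (u 0 2) = gen K (v 0 0) (v 0 1) (v 0 2).
      by have := congr1 (fun f => f 1) uv; rewrite /tensor !mul1r.
    move/(congr1 ( *%R^~ (gen K (- v 0 0) (- v 0 1) (- v 0 2)))).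
    rewrite -!genD !subrr gen0 => /gen_eq1[u0 u1 u2].
    have rowE (w : 'rV[int]_3) j : w 0 j = nth 0 [:: w 0 0; w 0 1; w 0 2] j.
      by case: j => [[|[|[|//]]] lt]; congr (w 0 _); apply: val_inj.
    apply/rowP => j; rewrite rowE [RHS]rowE.
    by rewrite (subr0_eq u0) (subr0_eq u1) (subr0_eq u2).
  - exists (\row_(l < 3) nth 0 [:: i; j; k] l) => //.
    by rewrite !mxE.
have gx i : tensor (gen K i 0 0) = tensor (OO K i).
  by rewrite /gen (_ : hcomb _ _ _ _ _ _ _ = 1) ?mulr1 // /hcomb; ring.
have gb : gen K 0 1 0 = OO K 0 + OP K 2 *+ 2 + OP K 1 *+ 3 + OP K 0 *+ 4.
  by rewrite /gen !OP_hyp /hcomb OO0; ring.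
have gc : gen K 0 0 1 = OO K 0 + OP K 0.
  by rewrite /gen !OP_hyp /hcomb OO0; ring.
rewrite -gb -gc -gx; apply/seteqP; split=> [f|f].
  rewrite Isom_eE => -[[[i j] k] _ <-] H [HG HS] /=.
  have t0 : tensor (gen K 0 0 0) = id.
    by rewrite gen0; apply/funext => E; rewrite /tensor mulr1.
  have [_ Hcomp _] := HG.
  have -> : gen K i j k = gen K (i + 0 + 0) (0 + j + 0) (0 + 0 + k).
    by rewrite !addr0 !add0r.
  rewrite !tensorD.
  apply: (Hcomp); first apply: (Hcomp).
  - apply: (@bij_group_intpow _ _ (fun i => tensor (gen K i 0 0))) => //.
      by move=> a b; rewrite -tensorD addr0.
    by apply: HS; left; left.
  - apply: (@bij_group_intpow _ _ (fun j => tensor (gen K 0 j 0))) => //.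
      by move=> a b; rewrite -tensorD addr0.
    by apply: HS; left; right.
  - apply: (@bij_group_intpow _ _ (fun k => tensor (gen K 0 0 k))) => //.
      by move=> a b; rewrite -tensorD addr0.
    by apply: HS; right.
apply; split; last first.
  by move=> _ [[->|->]|->]; exact: gen_Isom_e.
rewrite Isom_eE; split.
- exists (0, 0, 0) => //=.
  by rewrite gen0; apply/funext => E; rewrite /tensor mulr1.
- move=> _ _ [[[i j] k] _ <-] [[[i' j'] k'] _ <-].
  by exists (i + i', j + j', k + k') => //=; rewrite tensorD.
- move=> _ [[[i j] k] _ <-]; exists (tensor (gen K (- i) (- j) (- k))).
    by exists (- i, - j, - k).
  by split=> E; rewrite /tensor /= -mulrA -genD ?subrr ?addNr gen0 mulr1.
Qed.
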